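(* Let $k\ge 3$ and let the James–Stein statistic be $$\tilde\mu(y)=\left(1-\frac{k-2}{\|y\|^{2}}\right)y,\qquad y\in\mathbb{R}^k\setminus\{0\}.$$ Then every nonzero value $t$ of $\tilde\mu$ has exactly two preimages under $\tilde\mu$, namely $$y_1=r_1\,\frac{t}{\|t\|},\qquad y_2=-\,r_2\,\frac{t}{\|t\|},$$ for some positive real numbers $r_1,r_2$ (depending on $t$) satisfying $r_2<\sqrt{k-2}<r_1$.
   Context: $\|\cdot\|$ is the Euclidean norm on $\mathbb{R}^k$. *)

(* Defs.v *)
From mathcomp Require Import all_boot all_order all_algebra.
From mathcomp Require Import classical_sets reals.

Set Implicit Arguments.
Unset Strict Implicit.
Unset Printing Implicit Defensive.

Import Order.TTheory GRing.Theory Num.Theory.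

Local Open Scope ring_scope.
Local Open Scope classical_set_scope.

(* Not `|x|, which is the sup norm on row vectors in MathComp-Analysis. *)
Definition enorm (R : realType) (k : nat) (x : 'rV[R]_k) : R :=
  Num.sqrt (\sum_(i < k) x 0 i ^+ 2).

Definition nonzero_vectors (R : realType) (k : nat) : set 'rV[R]_k :=
  [set y | y != 0].

(* Total function; it is only meaningful on [nonzero_vectors R k], and
   statements about it restrict to that domain explicitly. *)
Definition james_stein (R : realType) (k : nat) (y : 'rV[R]_k) : 'rV[R]_k :=
  (1 - (k%:R - 2) / enorm y ^+ 2) *: y.

(* Main.v *)
Require Import Defs.
From mathcomp Require Import all_boot all_order all_algebra.
From mathcomp Require Import classical_sets reals.
From mathcomp Require Import ring lra.

Set Implicit Arguments.
Unset Strict Implicit.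
Unset Printing Implicit Defensive.

Import Order.TTheory GRing.Theory Num.Theory.

Local Open Scope ring_scope.
Local Open Scope classical_set_scope.

(** The statistic acts inside each line through the origin: if [u] is a unit
    vector, [c = k - 2] and [a] is nonzero, it sends [a *: u] to
    [(a - c / a) *: u] (lemma [james_stein_on_line]).  Conversely, a preimage
    of [t = s *: u], where [s] is the norm of [t], is a multiple [a *: u]
    (lemma [james_stein_preimage_collinear]), and [a] solves [a - c / a = s],
    that is, [a ^+ 2 - s * a - c = 0].  The product of the two roots of this
    quadratic is [- c < 0], so they are [r1] and [- r2] with [r1, r2 > 0],
    [r1 - r2 = s] and [r1 * r2 = c] (lemmas [quadratic_roots] and
    [sub_div_eq_roots]).  Since [r2 < r1] and [sqrt c] is the geometric mean
    of [r1] and [r2], it lies strictly between them. *)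

Section EuclideanNorm.
Variables (R : realType) (k : nat).
Implicit Types (a : R) (x : 'rV[R]_k).

Lemma sqr_enorm x : enorm x ^+ 2 = \sum_(i < k) x 0 i ^+ 2.
Proof. by rewrite sqr_sqrtr // sumr_ge0 // => i _; rewrite sqr_ge0. Qed.

Lemma enormZ a x : enorm (a *: x) = `|a| * enorm x.
Proof.
rewrite /enorm -sqrtr_sqr -sqrtrM ?sqr_ge0 // mulr_sumr; congr Num.sqrt.
by apply: eq_bigr => i _; rewrite mxE exprMn.
Qed.

Lemma enorm_gt0 x : x != 0 -> 0 < enorm x.
Proof.
move=> x0; rewrite lt_def sqrtr_ge0 andbT -sqrf_eq0 sqr_enorm.
apply: contraNneq x0 => /eqP.
rewrite psumr_eq0 => [/allP x0|i _]; last exact: sqr_ge0.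
apply/eqP/rowP => i; rewrite mxE; apply/eqP.
by rewrite -sqrf_eq0; apply: x0; rewrite mem_index_enum.
Qed.

Lemma enorm_normalize x : x != 0 -> enorm ((enorm x)^-1 *: x) = 1.
Proof.
move=> /enorm_gt0 x0.
by rewrite enormZ ger0_norm ?invr_ge0 ?ltW // mulVf // gt_eqF.
Qed.

Lemma james_stein_on_line a x : enorm x = 1 -> a != 0 ->
  james_stein (a *: x) = (a - (k%:R - 2) / a) *: x.
Proof.
move=> x1 a0; rewrite /james_stein enormZ x1 mulr1 real_normK ?num_real //.
by rewrite scalerA; congr (_ *: _); field.
Qed.

(** If [t] is nonzero, then the factor by which the statistic scales a
    preimage is nonzero and can be inverted. *)
Lemma james_stein_preimage_collinear x :
  james_stein x != 0 -> exists b, x = b *: james_stein x.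
Proof.
rewrite /james_stein scaler_eq0 negb_or => /andP[m0 _].
by exists (1 - (k%:R - 2) / enorm x ^+ 2)^-1; rewrite scalerA mulVf ?scale1r.
Qed.

End EuclideanNorm.

(** [r1] and [- r2] are the roots of [X ^+ 2 - s * X - c]; its discriminant
    exceeds [s ^+ 2], so the roots have opposite signs. *)
Lemma quadratic_roots (R : rcfType) (s c : R) : 0 < c ->
  exists r1 r2 : R, [/\ 0 < r1, 0 < r2, r1 - r2 = s & r1 * r2 = c].
Proof.
move=> c0; set d := Num.sqrt (s ^+ 2 + 4 * c).
have d2 : d ^+ 2 = s ^+ 2 + 4 * c.
  by rewrite sqr_sqrtr // addr_ge0 ?sqr_ge0 // mulr_ge0 // ltW.
have /ltr_normlP[sd1 sd2] : `|s| < d.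
  rewrite -sqrtr_sqr ltr_sqrt ?ltrDl ?mulr_gt0 //.
  by apply: ltr_wpDl; rewrite ?sqr_ge0 ?mulr_gt0.
exists ((d + s) / 2), ((d - s) / 2); split; [lra|lra|by field|].
have -> : (d + s) / 2 * ((d - s) / 2) = (d ^+ 2 - s ^+ 2) / 4 by field.
by rewrite d2; field.
Qed.

Lemma geometric_mean_between (R : rcfType) (r1 r2 : R) : 0 < r2 -> r2 < r1 ->
  r2 < Num.sqrt (r1 * r2) < r1.
Proof.
move=> r20 lt21; have r10 := lt_trans r20 lt21.
rewrite -{1}(ger0_norm (ltW r20)) -{3}(ger0_norm (ltW r10)) -!sqrtr_sqr.
by rewrite !ltr_sqrt ?exprn_gt0 ?mulr_gt0 // !expr2 ltr_pM2r // ltr_pM2l ?lt21.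
Qed.

Lemma sub_div_eq_roots (R : fieldType) (r1 r2 a : R) : a != 0 ->
  (a - r1 * r2 / a == r1 - r2) = (a == r1) || (a == - r2).
Proof.
move=> a0; rewrite -subr_eq0.
have -> : a - r1 * r2 / a - (r1 - r2) = (a - r1) * (a + r2) / a by field.
by rewrite !mulf_eq0 invr_eq0 (negbTE a0) orbF subr_eq0 addr_eq0.
Qed.

Theorem mainTheorem5 (R : realType) (k : nat) (hk : (3 <= k)%N)
    (t : 'rV[R]_k)
    (ht : (@james_stein R k @` @nonzero_vectors R k) t) (ht0 : t != 0) :
  exists r1 r2 : R,
    let y1 := r1 *: ((enorm t)^-1 *: t) in
    let y2 := - (r2 *: ((enorm t)^-1 *: t)) in
    [/\ 0 < r1, 0 < r2,
        r2 < Num.sqrt (k%:R - 2) /\ Num.sqrt (k%:R - 2) < r1,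
        y1 != y2 &
        @nonzero_vectors R k `&` @james_stein R k @^-1` [set t]
          = [set y1; y2]].
Proof.
have c0 : 0 < k%:R - 2 :> R by rewrite subr_gt0 ltr_nat.
have s0 := enorm_gt0 ht0.
have [r1 [r2 [r10 r20 rs rc]]] := quadratic_roots (enorm t) c0.
have u1 := enorm_normalize ht0.
set u := (enorm t)^-1 *: t in u1 *.
have tE : t = enorm t *: u by rewrite scalerA mulfV ?scale1r // gt_eqF.
have u0 : u != 0 by apply: contraNneq ht0 => u0; rewrite tE u0 scaler0.
have lineP a : a != 0 ->
    (james_stein (a *: u) == t) = (a == r1) || (a == - r2).
  move=> a0; rewrite james_stein_on_line // [X in _ == X]tE -subr_eq0.
  rewrite -scalerBl scaler_eq0 (negbTE u0) orbF subr_eq0 -rc -rs.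
  exact: sub_div_eq_roots.
have r1N0 : r1 != 0 by rewrite gt_eqF.
have r2N0 : - r2 != 0 by rewrite oppr_eq0 gt_eqF.
exists r1, r2 => y1 y2.
have y2E : y2 = (- r2) *: u by rewrite scaleNr.
split=> //.
- by rewrite -rc; apply/andP/geometric_mean_between => //; rewrite -subr_gt0 rs.
- rewrite y2E /y1 -subr_eq0 -scalerBl scaler_eq0 (negbTE u0) orbF opprK.
  by rewrite gt_eqF ?addr_gt0.
apply/seteqP; split=> y /=.
- move=> [/eqP y0 jy].
  have [b yE] : exists b, y = b *: t.
    by rewrite -jy; apply: james_stein_preimage_collinear; rewrite jy.
  have {}yE : y = (b * enorm t) *: u by rewrite -scalerA -tE.
  have a0 : b * enorm t != 0.
    by apply/eqP => a0; apply: y0; rewrite yE a0 scale0r.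
  have := lineP _ a0; rewrite -yE jy eqxx => /esym/orP[]/eqP aE.
    by left; rewrite yE aE.
  by right; rewrite y2E yE aE.
- move=> yE; have {yE}[a [a0 yE aP]] :
      exists a, [/\ a != 0, y = a *: u & (a == r1) || (a == - r2)].
    by case: yE => ->; [exists r1 | exists (- r2)];
      rewrite ?y2E ?eqxx ?orbT; split.
  rewrite /nonzero_vectors /= yE scaler_eq0 negb_or a0 u0; split => //.
  by apply/eqP; rewrite lineP.
Qed.
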